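(* Let $G=(V,E)$ be a finite connected undirected simple graph, let $\mathcal{X}=\{0,1,\ldots,m-1\}$ be a finite state space, and let $\theta^*\in\mathbb{R}^{\mathcal{I}}$ be an arbitrary real parameter vector of a pairwise model on $G$, with log partition function $\Phi(\theta^* )$. For $\mu_e=\{\mu_{st}\mid (s,t)\in E\}$ in the spanning tree polytope $\mathbb{T}(G)$ and $\mathbf{T}$ in the set $\mathbb{C}$ of locally consistent pseudomarginals, let $$\mathcal{F}(\mathbf{T};\mu_e;\theta^* )=-\sum_{s\in V}H_s(T_s)+\sum_{(s,t)\in E}\mu_{st}\,I_{st}(T_{st})-\sum_{\alpha\in\mathcal{I}}T_\alpha\theta^*_\alpha ,\qquad \mathcal{H}(\mu_e;\theta^* )=\min_{\mathbf{T}\in\mathbb{C}}\mathcal{F}(\mathbf{T};\mu_e;\theta^* ).$$ Then the following upper bound, jointly optimized over both $\mathbf{T}$ and $\mu_e$, holds: $$\Phi(\theta^* )\le-\max_{\mu_e\in\mathbb{T}(G)}\mathcal{H}(\mu_e;\theta^* )=-\max_{\mu_e\in\mathbb{T}(G)}\ \min_{\mathbf{T}\in\mathbb{C}}\mathcal{F}(\mathbf{T};\mu_e;\theta^* ).$$ The function $\mu_e\mapsto\mathcal{H}(\mu_e;\theta^* )$ has a global maximum over $\mathbb{T}(G)$, attained at some $\widehat{\mu_e}\in\mathbb{T}(G)$, which yields the tightest possible upper bound: $\Phi(\theta^* )\le-\mathcal{H}(\widehat{\mu_e};\theta^* )\le-\mathcal{H}(\mu_e;\theta^* )$ for all $\m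u_e\in\mathbb{T}(G)$.
   Context: Model. Let $N=|V|$ and fix one orientation $(s,t)$ for each edge, so each undirected edge is listed once in $E$. The index set is $\mathcal{I}=\{(s;j)\mid s\in V,\ j\in\mathcal{X}\}\cup\{(st;jk)\mid (s,t)\in E,\ j,k\in\mathcal{X}\}$. The potentials on $\mathbf{x}=(x_s)_{s\in V}\in\mathcal{X}^N$ are the indicator functions $\phi_{s;j}(\mathbf{x})=\delta(x_s=j)$ and $\phi_{st;jk}(\mathbf{x})=\delta(x_s=j,\,x_t=k)$. For $\theta\in\mathbb{R}^{\mathcal{I}}$ the log partition function is $$\Phi(\theta)=\log\sum_{\mathbf{x}\in\mathcal{X}^N}\exp\Big\{\sum_{\alpha\in\mathcal{I}}\theta_\alpha\phi_\alpha(\mathbf{x})\Big\}.$$ Spanning tree polytope. Let $\mathfrak{T}$ be the set of spanning trees of $G$. For a probability distribution $\vec\mu=\{\mu(\mathcal{T})\}_{\mathcal{T}\in\mathfrak{T}}$ on $\mathfrak{T}$, the edge appearance probability of $e\in E$ is $\sum_{\mathcal{T}\in\mathfrak{T}:\,e\in E(\mathcal{T})}\mu(\mathcal{T})$. The spanning tree polytope $\mathbb{T}(G)\subset[0,1]^E$ is the set of all vectors of edge appearance probabilities arising in this way; equivalently, it is the convex hull of the edge-indicator vectors of the spanning trees of $G$. Pseudomarginals. A vector $\mathbf{T}=\{T_s,\ s\in V\}\cup\{T_{st},\ (s,t)\in E\}$ consists of nonnegative functions $T_s:\mathcal{X}\to[0,\infty)$ and $T_{st}:\mathcal{X}\times\mathcal{X}\to[0,\infty)$,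 and is identified with an element of $\mathbb{R}^{\mathcal{I}}$ via $T_{(s;j)}=T_s(j)$, $T_{(st;jk)}=T_{st}(j,k)$. The constraint set $\mathbb{C}$ consists of all such $\mathbf{T}$ with $\sum_{x_s}T_s(x_s)=1$ for all $s\in V$, and $\sum_{x_t}T_{st}(x_s,x_t)=T_s(x_s)$ and $\sum_{x_s}T_{st}(x_s,x_t)=T_t(x_t)$ for all $(s,t)\in E$ and all $x_s$, $x_t$ in $\mathcal{X}$ respectively. Entropies (convention $0\log 0=0$, natural logarithm). $H_s(T_s)=-\sum_{x_s}T_s(x_s)\log T_s(x_s)$, and $I_{st}(T_{st})=\sum_{x_s,x_t}T_{st}(x_s,x_t)\log\frac{T_{st}(x_s,x_t)}{T_s(x_s)T_t(x_t)}$ is the mutual information of $T_{st}$, where terms with $T_{st}(x_s,x_t)=0$ are taken to be $0$. *)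

(* Defs.v *)
From HB Require Import structures.
From mathcomp Require Import all_boot all_order all_algebra.
From mathcomp Require Import boolp classical_sets reals sequences exp.

Set Implicit Arguments.
Unset Strict Implicit.
Unset Printing Implicit Defensive.

Import Order.TTheory GRing.Theory Num.Theory.
Local Open Scope classical_set_scope.
Local Open Scope ring_scope.

Definition simple_graph (V : finType) (adj : rel V) : Prop :=
  symmetric adj /\ irreflexive adj.

Definition connected_graph (V : finType) (adj : rel V) : Prop :=
  forall s t, connect adj s t.

(* A simple cycle of a simple graph has at least three vertices; the sequences
   [:: s; t] along an edge st satisfy ucycle but are not cycles of the graph. *)
Definition acyclic_graph (V : finType) (adj : rel V) : Prop :=
  forall c : seq V, (2 < size c)%N -> ~ ucycle adj c.

(* E lists every edge of adj exactly once, as (s, t) or as (t, s). *)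
Definition orientation (V : finType) (adj : rel V) (E : {set V * V}) : Prop :=
  (forall s t, adj s t = ((s, t) \in E) || ((t, s) \in E)) /\
  (forall s t, (s, t) \in E -> (t, s) \notin E).

Definition edge (V : finType) (E : {set V * V}) := {a : V * V | a \in E}.

Definition src (V : finType) (E : {set V * V}) (a : edge E) : V := (val a).1.
Definition tgt (V : finType) (E : {set V * V}) (a : edge E) : V := (val a).2.

(* inl (s, j) is the index (s;j); inr (a, (j, k)) is (st;jk) for a = (s,t). *)
Definition model_index (V : finType) (E : {set V * V}) (m : nat) :=
  ((V * 'I_m) + (edge E * ('I_m * 'I_m)))%type.

Section Model.
Context {R : realType} {V : finType} {E : {set V * V}} {m : nat}.
Implicit Types (T theta : model_index E m -> R) (w : edge E -> R).

Definition potential (i : model_index E m) (x : {ffun V -> 'I_m}) : R :=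
  match i with
  | inl (s, j) => (x s == j)%:R
  | inr (a, (j, k)) => ((x (src a) == j) && (x (tgt a) == k))%:R
  end.

Definition log_partition theta : R :=
  ln (\sum_(x : {ffun V -> 'I_m}) expR (\sum_i theta i * potential i x)).

Definition node_marg T (s : V) : 'I_m -> R := fun j => T (inl (s, j)).
Definition edge_marg T (a : edge E) : 'I_m -> 'I_m -> R :=
  fun j k => T (inr (a, (j, k))).

Definition pseudomarginals : set (model_index E m -> R) :=
  [set T | [/\ forall i, 0 <= T i,
               forall s, \sum_j node_marg T s j = 1,
               forall a j, \sum_k edge_marg T a j k = node_marg T (src a) j &
               forall a k, \sum_j edge_marg T a j k = node_marg T (tgt a) k]].

(* The convention 0 log 0 = 0 holds since 0 * y = 0 for every y : R. *)
Definition entropy (p : 'I_m -> R) : R := - \sum_j p j * ln (p j).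

(* Terms with q j k = 0 vanish because of the factor q j k. *)
Definition mutual_info (p p' : 'I_m -> R) (q : 'I_m -> 'I_m -> R) : R :=
  \sum_j \sum_k q j k * ln (q j k / (p j * p' k)).

Definition free_energy T w theta : R :=
  - (\sum_s entropy (node_marg T s))
  + \sum_a w a * mutual_info (node_marg T (src a)) (node_marg T (tgt a))
                             (edge_marg T a)
  - \sum_i T i * theta i.

Definition min_free_energy w theta : R :=
  inf [set free_energy T w theta | T in pseudomarginals].

End Model.

Section SpanningTrees.
Context {V : finType} (E : {set V * V}).

Definition sub_adj (A : {set edge E}) : rel V :=
  fun s t => [exists a in A, (val a == (s, t)) || (val a == (t, s))].

Definition is_spanning_tree (A : {set edge E}) : Prop :=
  connected_graph (sub_adj A) /\ acyclic_graph (sub_adj A).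

Definition spanning_tree := {A : {set edge E} | `[< is_spanning_tree A >]}.

Definition tree_distribution {R : realType} (mu : spanning_tree -> R) : Prop :=
  (forall A, 0 <= mu A) /\ \sum_A mu A = 1.

Definition edge_appearance {R : realType} (mu : spanning_tree -> R) :
    edge E -> R :=
  fun a => \sum_(A : spanning_tree | a \in val A) mu A.

Definition spanning_tree_polytope (R : realType) : set (edge E -> R) :=
  [set edge_appearance mu | mu in [set mu | tree_distribution mu]].

End SpanningTrees.

Arguments spanning_tree_polytope {V} E R _.

Definition is_minimum {R : realType} (S : set R) (x : R) : Prop :=
  S x /\ lbound S x.
Definition is_maximum {R : realType} (S : set R) (x : R) : Prop :=
  S x /\ ubound S x.

(* Main.v *)
Require Import Defs.
From HB Require Import structures.
From mathcomp Require Import all_boot all_order all_algebra.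
From mathcomp Require Import boolp classical_sets reals sequences exp.
From mathcomp Require Import topology normedtype derive realfun.
Set Implicit Arguments.
Unset Strict Implicit.
Unset Printing Implicit Defensive.
Import Order.TTheory GRing.Theory Num.Theory.
Import numFieldNormedType.Exports.
Local Open Scope classical_set_scope.
Local Open Scope ring_scope.

(* Let p be the Gibbs distribution of theta and T its marginals, which lie in
   the constraint set.  For a spanning tree A the function
   q = prod_s T_s * prod_(st in A) T_st / (T_s T_t) sums to 1 (remove leaves one
   at a time), so Gibbs' inequality sum p ln q <= sum p ln p says that the free
   energy of T for the indicator of A is at most - log_partition theta.  The
   free energy is affine in the edge weights, so the bound extends to the whole
   spanning tree polytope.  The minimum over T exists because on the constraint
   set the free energy agrees with a function built from x ln x, which is
   continuous at 0; the maximum over the polytope exists because mutual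
   information is bounded, whence the minimum is Lipschitz in the weights. *)

(** * Forests and spanning trees *)

(** Without a leaf, every vertex with a neighbour [u] has a second one. A simple path can then be
    prolonged at its head forever, unless it closes into a cycle; finiteness excludes the first and
    acyclicity the second. *)
Lemma acyclic_leaf (V : finType) (e : rel V) :
    symmetric e -> irreflexive e -> acyclic_graph e ->
    (exists s t, e s t) ->
  exists v u, e v u /\ forall z, e v z -> z = u.
Proof.
move=> esym eirr eacy [s0 [t0 est]]; apply: contrapT => noleaf.
have branch v u : e v u -> exists2 z, e v z & z != u.
  move=> evu; apply: contrapT => nz; apply: noleaf; exists v, u; split => // z evz.
  by apply/eqP; apply: contra_notT nz => zu; exists z.
have long n : exists x y p, path e x (y :: p) && uniq (x :: y :: p) /\ size p = n.
  elim: n => [|n [x [y [p [/andP[xyp uxyp] sp]]]]].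
    exists s0, t0, [::]; rewrite /= est inE !andbT; split => //.
    by apply: contraTneq est => ->; rewrite eirr.
  have /branch[z exz zy] : e x y by case/andP: xyp.
  have zx : z != x by apply: contraTneq exz => ->; rewrite eirr.
  (* If [z] is already on the path, it lies beyond [y], so the segment from [x] to [z] and the edge
     [x z] form a cycle on at least three vertices. *)
  have [zp|zNp] := boolP (z \in p).
    case/path.splitP: zp xyp uxyp => p1 p2; rewrite -cat_cons cat_path => /andP[pc _].
    rewrite -!cat_cons cat_uniq => /andP[uc _].
    case: (eacy (x :: y :: rcons p1 z)); first by rewrite /= size_rcons.
    rewrite /ucycle /cycle rcons_path; apply/andP; split => //.
    by apply/andP; split => //=; rewrite last_rcons esym.
  exists z, x, (y :: p); rewrite /= sp; split => //.
  by move: xyp uxyp => /= -> ->; rewrite esym exz !inE !negb_or zx zy zNp.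
(* A simple path with [#|V| + 2] vertices is too long. *)
have [x [y [p [/andP[_ u] sp]]]] := long #|V|.
have := max_card (mem (x :: y :: p)); rewrite (card_uniqP u) /= sp.
by rewrite ltnNge leqW.
Qed.

Section Graph.
Context {V : finType} {E : {set V * V}}.

Lemma sub_adjP (A : {set edge E}) s t :
  reflect (exists2 a, a \in A & (val a == (s, t)) || (val a == (t, s)))
          (sub_adj A s t).
Proof. exact: exists_inP. Qed.

Lemma sub_adj_sym (A : {set edge E}) : symmetric (sub_adj A).
Proof. by move=> s t; apply: eq_existsb => a; rewrite orbC. Qed.

Lemma acyclic_sub_adj (A B : {set edge E}) :
  A \subset B -> acyclic_graph (sub_adj B) -> acyclic_graph (sub_adj A).
Proof.
move=> AB acB c c2 /andP[cA uc]; apply: (acB c c2); apply/andP; split => //.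
apply: sub_cycle cA => s t /fintype.existsP[a /andP[aA h]].
by apply/fintype.existsP; exists a; rewrite (fintype.subsetP AB).
Qed.

Context {adj : rel V}.
Hypothesis E_orient : orientation adj E.

(** A loop would be its own reversal, which the second clause of [orientation] forbids. *)
Lemma edge_loopless (a : edge E) : src a != tgt a.
Proof.
have := E_orient.2 (src a) (tgt a); rewrite /src /tgt -surjective_pairing.
move=> /(_ (valP a)) h; apply: contraNneq h => st.
by have := valP a; rewrite [val a]surjective_pairing {1}st -{2}st.
Qed.

(** [sub_adj] only records unordered endpoints; as [E] holds a single orientation of each edge,
    these determine the edge. *)
Lemma edge_inj (a b : edge E) s t :
    (val a == (s, t)) || (val a == (t, s)) ->
    (val b == (s, t)) || (val b == (t, s)) -> a = b.
Proof.
have no u v : (u, v) \in E -> (v, u) \in E -> False.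
  by move=> /(E_orient.2)/negP h /h.
case/orP => /eqP ha; case/orP => /eqP hb; apply/val_inj => /=;
  rewrite ha hb //; exfalso; have := valP a; have := valP b; rewrite ha hb.
  by move=> /no h /h.
by move=> /no h /h.
Qed.

Lemma sub_adj_irr (A : {set edge E}) : irreflexive (sub_adj A).
Proof.
move=> s; apply/negbTE/negP => /sub_adjP[a _]; rewrite orbb => /eqP h.
by have := edge_loopless a; rewrite /src /tgt h eqxx.
Qed.

(** A connected edge set of least cardinality is acyclic: an edge on a cycle could be deleted, since
    the rest of the cycle still joins its ends. *)
Lemma spanning_tree_exists :
  connected_graph adj -> exists A : {set edge E}, is_spanning_tree A.
Proof.
move=> adj_conn.
pose P (A : {set edge E}) := `[< connected_graph (sub_adj A) >].
have PT : P [set: edge E]%SET.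
  apply/asboolP => s t; have := adj_conn s t.
  rewrite (@eq_connect _ _ (sub_adj [set: edge E]%SET)) //.
  move=> {s t} s t; rewrite E_orient.1; apply/idP/sub_adjP => [|[a _]].
    by case/orP => h; exists (exist (fun a => is_true (a \in E)) _ h);
      rewrite ?inE /= ?eqxx ?orbT.
  by case/orP => /eqP <-; rewrite (valP a) ?orbT.
case: (@arg_minnP _ _ P (fun A => #|A|) PT) => A /asboolP Aconn Amin.
(* Let the cycle be [x, y, z, r]; the edge to delete is the one joining [x] and [y]. *)
exists A; split => // -[|x [|y [|z r]]] // _ /andP[/=].
move=> /and3P[xy yz]; rewrite rcons_path => /andP[zr lx].
move=> /and3P[]; rewrite !inE !negb_or => /and3P[xNy xNz xNr] /andP[yNz yNr] _.
have /sub_adjP[a aA axy] := xy.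
have keep s t : (s, t) != (x, y) -> (s, t) != (y, x) -> sub_adj A s t ->
    sub_adj (A :\ a) s t.
  move=> n1 n2 /sub_adjP[b bA hb]; apply/sub_adjP; exists b => //.
  rewrite !inE bA andbT; apply: contraTneq hb => ->.
  case/orP: axy => /eqP ->; rewrite negb_or [in X in _ && X]eq_sym; move: n1 n2;
    by rewrite !xpair_eqE ![_ == x]eq_sym ![_ == y]eq_sym;
    do 4 case: eqP.
have yx : connect (sub_adj (A :\ a)) y x.
  apply/connectP; exists (rcons (z :: r) x); last by rewrite last_rcons.
  rewrite rcons_path; apply/andP; split.
    (* The walk [y, z, r] avoids [x], hence the deleted edge; the closing step into [x] starts from
       a vertex other than [y]. *)
    apply: (@sub_in_path _ [pred u | u != x] (sub_adj A)).
    - move=> s t; rewrite !inE => sx tx.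
      by apply: keep; rewrite xpair_eqE negb_and ?sx ?tx ?orbT.
    - rewrite /= ![_ == x]eq_sym xNy xNz /=; apply/allP => u ur /=.
      by apply: contraNneq xNr => <-.
    - by rewrite /= yz.
  have yNl : last z r != y.
    by apply: contraTneq (mem_last z r) => ->; rewrite inE negb_or yNz.
  by apply: keep lx; rewrite xpair_eqE negb_and ?yNl // eq_sym xNy orbT.
suff /Amin : P (A :\ a)%SET by rewrite (cardsD1 a A) aA ltnn.
apply/asboolP => s t; have := Aconn s t; apply: connect_sub => {}s {}t st.
have [[-> ->]|n1] := eqVneq (s, t) (x, y).
  by rewrite (sym_connect_sym (@sub_adj_sym _)).
have [[-> ->]//|n2] := eqVneq (s, t) (y, x).
exact/connect1/keep.
Qed.

End Graph.

(** * Summing edge factors over a forest *)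

Section ForestSum.
Context {R : realFieldType} {V K : finType}.
Implicit Types (p : V -> K -> R) (x : {ffun V -> K}).

Definition upd x v k : {ffun V -> K} := [ffun u => if u == v then k else x u].

(** Coordinate [v] may be redrawn independently: exchanging [x v] with [k] is an involution on pairs
    [(x, k)] that preserves the product weight. *)
Lemma resample p v (f : {ffun V -> K} -> R) :
    \sum_k p v k = 1 ->
  \sum_(x : {ffun V -> K}) (\prod_s p s (x s)) * f x =
  \sum_(x : {ffun V -> K}) (\prod_s p s (x s)) * \sum_k p v k * f (upd x v k).
Proof.
move=> p1.
pose h (xk : {ffun V -> K} * K) := (upd xk.1 v xk.2, xk.1 v).
have hh : involutive h.
  move=> [x k]; rewrite /h /= ffunE eqxx; congr (_, _).
  by apply/ffunP => u; rewrite !ffunE; case: eqP => [->|].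
transitivity (\sum_(x : {ffun V -> K}) \sum_k (\prod_s p s (x s)) * f x * p v k).
  by apply: eq_bigr => x _; rewrite -mulr_sumr p1 mulr1.
under [RHS]eq_bigr do rewrite mulr_sumr.
rewrite !pair_bigA /= (reindex_inj (inv_inj hh)) /=.
apply: eq_bigr => -[x k] _ /=.
rewrite (bigD1 v) //= ffunE eqxx [in RHS](bigD1 v) //=.
under eq_bigr => u uv do rewrite ffunE (negPf uv).
by rewrite mulrC -!mulrA; congr (_ * _); rewrite mulrCA.
Qed.

Context {adj : rel V} {E : {set V * V}}.
Hypothesis E_orient : orientation adj E.

(** Induction on the number of edges. Redrawing the value at a leaf integrates the factor of its
    only edge to 1, which leaves the sum for the forest without that edge. *)
Lemma forest_sum p (r : edge E -> K -> K -> R) (A : {set edge E}) :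
    (forall s, \sum_j p s j = 1) ->
    (forall a j, \sum_k p (tgt a) k * r a j k = 1) ->
    (forall a k, \sum_j p (src a) j * r a j k = 1) ->
    acyclic_graph (sub_adj A) ->
  \sum_(x : {ffun V -> K})
    (\prod_s p s (x s)) * \prod_(a in A) r a (x (src a)) (x (tgt a)) = 1.
Proof.
move=> p1 rl rr; have [n] := ubnP #|A|; elim: n A => // n IH A An Aac.
have [->|[a0 a0A]] := set_0Vmem A.
  under eq_bigr do rewrite big_set0 mulr1.
  by rewrite -bigA_distr_bigA big1 // => s _; exact: p1.
have [v [u [/sub_adjP[a aA avu] uniq_nbr]]] : exists v u,
    sub_adj A v u /\ forall z, sub_adj A v z -> z = u.
  apply: acyclic_leaf => //; [exact: sub_adj_sym|exact: (sub_adj_irr E_orient)|].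
  by exists (src a0), (tgt a0); apply/sub_adjP; exists a0 => //;
    rewrite /src /tgt -surjective_pairing eqxx.
rewrite -[RHS](IH (A :\ a)); first last.
- by apply: acyclic_sub_adj Aac; exact: subsetDl.
- by move: An; rewrite (cardsD1 a A) aA.
rewrite [LHS](@resample _ v) ?p1 //; apply: eq_bigr => x _; congr (_ * _).
(* An edge touching [v] must end at its only neighbour [u], so it is [a]; the remaining factors do
   not see the value at [v]. *)
have away b : b \in A :\ a -> (src b != v) && (tgt b != v).
  rewrite !inE => /andP[ba bA]; rewrite -negb_or; apply: contra ba => hv.
  apply/eqP; apply: (edge_inj E_orient _ avu).
  have vb : val b = (src b, tgt b) by exact: surjective_pairing.
  case/orP: hv => /eqP hv.
    have -> : u = tgt b.
      by apply/esym/uniq_nbr/sub_adjP; exists b; rewrite // vb hv eqxx.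
    by rewrite vb hv eqxx.
  have -> : u = src b.
    by apply/esym/uniq_nbr/sub_adjP; exists b; rewrite // vb hv eqxx orbT.
  by rewrite vb hv eqxx orbT.
transitivity (\sum_k p v k * r a (upd x v k (src a)) (upd x v k (tgt a)) *
    \prod_(b in A :\ a) r b (x (src b)) (x (tgt b))).
  apply: eq_bigr => k _; rewrite (big_setD1 a) //= mulrA; congr (_ * _).
  apply: eq_bigr => b /away/andP[sb tb].
  by rewrite !ffunE (negPf sb) (negPf tb).
rewrite -mulr_suml -[RHS]mul1r; congr (_ * _).
have := edge_loopless E_orient a.
(* The leaf is either the source or the target of [a], which decides between the normalisations [rr]
   and [rl]. *)
case/orP: avu => /eqP avu; rewrite /src /tgt avu /= => uv.
  rewrite -[RHS](rr a (x (tgt a))); apply: eq_bigr => k _.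
  by rewrite /src /tgt avu !ffunE eqxx eq_sym (negPf uv).
rewrite -[RHS](rl a (x (src a))); apply: eq_bigr => k _.
by rewrite /src /tgt avu !ffunE eqxx (negPf uv).
Qed.

End ForestSum.

(** * The Gibbs distribution *)

Lemma sum_delta (R : nzRingType) (I : finType) (i : I) (f : I -> R) :
  \sum_j (i == j)%:R * f j = f i.
Proof.
rewrite (bigD1 i) //= eqxx mul1r big1 ?addr0 // => j ji.
by rewrite eq_sym (negPf ji) mul0r.
Qed.

Section Gibbs.
Context {R : realType} {V : finType} {adj : rel V} {E : {set V * V}} {m : nat}.
Hypotheses (E_orient : orientation adj E) (m_gt0 : (0 < m)%N).
Variable theta : model_index E m -> R.

(** Normalising inside the exponent makes positivity immediate and [ln (gibbs x)] affine in the
    potentials. *)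
Definition gibbs (x : {ffun V -> 'I_m}) : R :=
  expR (\sum_i theta i * potential i x - log_partition theta).

Definition gibbs_marg (i : model_index E m) : R :=
  \sum_(x : {ffun V -> 'I_m}) gibbs x * potential i x.

Lemma gibbs_gt0 x : 0 < gibbs x.
Proof. exact: expR_gt0. Qed.

Lemma gibbs_sum1 : \sum_(x : {ffun V -> 'I_m}) gibbs x = 1.
Proof.
(* Positivity lets [expR] cancel the [ln] in [log_partition]; a configuration exists because [m] is
   positive. *)
have Z_gt0 : 0 < \sum_(x : {ffun V -> 'I_m}) expR (\sum_i theta i * potential i x).
  rewrite (bigD1 [ffun=> Ordinal m_gt0]) //= ltr_wpDr ?expR_gt0 //.
  by apply: sumr_ge0 => x _; exact: expR_ge0.
under eq_bigr do rewrite /gibbs expRD expRN.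
by rewrite -mulr_suml lnK ?posrE // mulfV // gt_eqF.
Qed.

Lemma gibbs_node (g : 'I_m -> R) s :
  \sum_(x : {ffun V -> 'I_m}) gibbs x * g (x s) =
  \sum_j node_marg gibbs_marg s j * g j.
Proof.
under eq_bigr => x _ do rewrite -(sum_delta (x s)) mulr_sumr.
rewrite exchange_big; apply: eq_bigr => j _; rewrite mulr_suml.
by apply: eq_bigr => x _; rewrite mulrA.
Qed.

Lemma gibbs_edge (g : 'I_m -> 'I_m -> R) a :
  \sum_(x : {ffun V -> 'I_m}) gibbs x * g (x (src a)) (x (tgt a)) =
  \sum_j \sum_k edge_marg gibbs_marg a j k * g j k.
Proof.
under eq_bigr => x _ do rewrite -(sum_delta (x (src a)) (g^~ (x (tgt a)))) mulr_sumr.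
rewrite exchange_big; apply: eq_bigr => j _.
under eq_bigr => x _ do rewrite -(sum_delta (x (tgt a)) (g j)) !mulr_sumr.
rewrite exchange_big; apply: eq_bigr => k _; rewrite mulr_suml.
by apply: eq_bigr => x _; rewrite /= -mulnb natrM !mulrA.
Qed.

(** Every index is realised by some configuration, an edge having distinct ends. Strict positivity
    keeps the quotients and logarithms in [forest_bound] away from default values. *)
Lemma gibbs_marg_gt0 i : 0 < gibbs_marg i.
Proof.
have [x xi] : exists x, potential i x = 1 :> R.
  case: i => [[s j]|[a [j k]]] /=; first by exists [ffun=> j]; rewrite ffunE eqxx.
  exists [ffun s => if s == src a then j else k].
  rewrite !ffunE eqxx [tgt a == _]eq_sym.
  by rewrite (negPf (edge_loopless E_orient a)) !eqxx.
rewrite /gibbs_marg (bigD1 x) //= ltr_wpDr ?xi ?mulr1 ?gibbs_gt0 //.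
apply: sumr_ge0 => y _; apply: mulr_ge0; first exact/ltW/gibbs_gt0.
by case: i {xi} => [[s j]|[a [j k]]] /=; rewrite ler0n.
Qed.

Lemma gibbs_marg_in : pseudomarginals gibbs_marg.
Proof.
split => [i|s|a j|a k]; first exact/ltW/gibbs_marg_gt0.
- rewrite -gibbs_sum1; under [RHS]eq_bigr do rewrite -[gibbs _]mulr1.
  by rewrite (gibbs_node (fun=> 1) s); under [RHS]eq_bigr do rewrite mulr1.
- rewrite exchange_big /=; apply: eq_bigr => x _; rewrite -mulr_sumr; congr (_ * _).
  rewrite /= -[RHS](sum_delta (x (tgt a)) (fun=> (x (src a) == j)%:R)).
  by apply: eq_bigr => k _; rewrite -mulnb natrM mulrC.
- rewrite exchange_big /=; apply: eq_bigr => x _; rewrite -mulr_sumr; congr (_ * _).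
  rewrite /= -[RHS](sum_delta (x (src a)) (fun=> (x (tgt a) == k)%:R)).
  by apply: eq_bigr => j _; rewrite -mulnb natrM.
Qed.

Lemma forest_bound (A : {set edge E}) : acyclic_graph (sub_adj A) ->
  - (\sum_s entropy (node_marg gibbs_marg s))
  + \sum_(a in A) mutual_info (node_marg gibbs_marg (src a))
                              (node_marg gibbs_marg (tgt a))
                              (edge_marg gibbs_marg a)
  - \sum_i gibbs_marg i * theta i <= - log_partition theta.
Proof.
move=> Aac; have [T_ge0 T_sum T_src T_tgt] := gibbs_marg_in.
pose p s j := node_marg gibbs_marg s j.
pose r a j k := edge_marg gibbs_marg a j k / (p (src a) j * p (tgt a) k).
have p_gt0 s j : 0 < p s j by exact: gibbs_marg_gt0.
have p_neq0 s j : p s j != 0 by rewrite gt_eqF.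
have r_gt0 a j k : 0 < r a j k by rewrite divr_gt0 ?mulr_gt0 // gibbs_marg_gt0.
pose q (x : {ffun V -> 'I_m}) :=
  (\prod_s p s (x s)) * \prod_(a in A) r a (x (src a)) (x (tgt a)).
have q_sum : \sum_(x : {ffun V -> 'I_m}) q x = 1.
  (* Both normalisations are the local consistency constraints divided by a positive node
     marginal. *)
  apply: (forest_sum E_orient) Aac => // [a j|a k].
    rewrite -[RHS](mulfV (p_neq0 (src a) j)) -[X in X / _](T_src a j) mulr_suml.
    apply: eq_bigr => k _; rewrite /r invfM mulrCA; congr (_ * _).
    by rewrite mulrCA mulfV ?mulr1.
  rewrite -[RHS](mulfV (p_neq0 (tgt a) k)) -[X in X / _](T_tgt a k) mulr_suml.
  apply: eq_bigr => j _; rewrite /r invfM mulrCA; congr (_ * _).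
  by rewrite mulrA mulfV ?mul1r.
have q_gt0 x : 0 < q x by rewrite mulr_gt0 // prodr_gt0.
have ln_prod (I : finType) (P : pred I) (f : I -> R) : (forall i, 0 < f i) ->
    ln (\prod_(i | P i) f i) = \sum_(i | P i) ln (f i).
  move=> f_gt0; apply: (big_morph_in Num.pos); last by move=> i _; exact: f_gt0.
  - exact: rpredM.
  - exact: rpred1.
  - exact: lnM.
  - exact: ln1.
(* [ln (q x)] splits into terms that depend on one vertex or one edge, so its mean under [gibbs]
   only involves the marginals. *)
have Eln : \sum_(x : {ffun V -> 'I_m}) gibbs x * ln (q x) =
    - (\sum_s entropy (p s)) +
    \sum_(a in A) mutual_info (p (src a)) (p (tgt a)) (edge_marg gibbs_marg a).
  under eq_bigr => x _.
    rewrite lnM ?posrE ?prodr_gt0 // !ln_prod // mulrDr !mulr_sumr; over.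
  rewrite big_split /= exchange_big [X in _ + X]exchange_big -sumrN; congr (_ + _).
    by apply: eq_bigr => s _; rewrite opprK (gibbs_node (fun j => ln (p s j))).
  by apply: eq_bigr => a _; rewrite (gibbs_edge (fun j k => ln (r a j k))).
rewrite -Eln lerBlDr.
have -> : - log_partition theta + \sum_i gibbs_marg i * theta i =
    \sum_(x : {ffun V -> 'I_m}) gibbs x * ln (gibbs x).
  under [RHS]eq_bigr => x _ do rewrite expRK mulrBr mulr_sumr.
  rewrite sumrB -mulr_suml gibbs_sum1 mul1r addrC exchange_big; congr (_ - _).
  apply: eq_bigr => i _; rewrite mulr_suml; apply: eq_bigr => x _.
  by rewrite mulrCA [LHS]mulrC.
(* Gibbs' inequality. Since [gibbs] and [q] both sum to 1, 0 is the sum of [gibbs x - q x], and the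
   comparison is made term by term from [ln t <= t - 1] at [t = q x / gibbs x]. *)
rewrite -subr_ge0 -sumrB -[leLHS](subrr (1 : R)) -{1}gibbs_sum1 -q_sum -sumrB.
apply: ler_sum => x _; rewrite -mulrBr.
have := @le_ln1Dx _ (q x / gibbs x - 1).
rewrite ltrBrDl subrr divr_gt0 ?gibbs_gt0 // addrC subrK => /(_ isT).
rewrite ln_div ?posrE ?gibbs_gt0 // => /(ler_wpM2l (ltW (gibbs_gt0 x))).
rewrite [leRHS]mulrBr mulr1 mulrCA mulfV ?gt_eqF ?gibbs_gt0 // mulr1.
by rewrite -lerN2 -mulrN !opprB.
Qed.

Lemma free_energy_gibbs w : spanning_tree_polytope E R w ->
  free_energy gibbs_marg w theta <= - log_partition theta.
Proof.
case=> mu [mu_ge0 mu_sum] <-.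
set h := - (\sum_s entropy (node_marg gibbs_marg s)) - \sum_i gibbs_marg i * theta i.
pose I a := mutual_info (node_marg gibbs_marg (src a))
  (node_marg gibbs_marg (tgt a)) (edge_marg gibbs_marg a).
(* Exchanging the sums over edges and trees writes the free energy as a [mu]-average of the
   quantities bounded by [forest_bound]. *)
have -> : free_energy gibbs_marg (edge_appearance mu) theta =
    \sum_(A : spanning_tree E) mu A * (h + \sum_(a in val A) I a).
  rewrite /free_energy addrAC -/h.
  under [RHS]eq_bigr do rewrite mulrDr.
  rewrite big_split /= -mulr_suml mu_sum mul1r; congr (_ + _).
  under [RHS]eq_bigr do rewrite mulr_sumr.
  rewrite (exchange_big_dep predT) //=; apply: eq_bigr => a _.
  by rewrite mulr_suml.
rewrite -[leRHS]mul1r -mu_sum mulr_suml; apply: ler_sum => A _.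
apply: ler_wpM2l => //; rewrite /h addrAC; apply: forest_bound.
by have /asboolP[] := valP A.
Qed.

End Gibbs.

(** * Continuity and compactness *)

(** With [s = Num.sqrt x] the right side is [2 s^2 ln s], and [ln (1/s) < 1/s]. For [x <= 0] both
    sides are 0, as [ln] and [Num.sqrt] take the value 0 there. *)
Lemma xlnx_ge (R : realType) (x : R) : - (Num.sqrt x *+ 2) <= x * ln x.
Proof.
have [x_le0|x_gt0] := leP x 0.
  by rewrite ln0 // mulr0 ler0_sqrtr // mul0rn oppr0.
set s := Num.sqrt x; have s_gt0 : 0 < s by rewrite sqrtr_gt0.
have -> : x = s ^+ 2 by rewrite sqr_sqrtr // ltW.
rewrite lnXn // mulrnAr -mulNrn lerMn2r /= lerNl -mulrN -lnV ?posrE //.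
have /ltW/(ler_wpM2l (ltW (exprn_gt0 2 s_gt0))) : ln s^-1 < s^-1.
  by rewrite ln_sublinear // invr_gt0.
by move=> /le_trans; apply; rewrite expr2 mulfK // gt_eqF.
Qed.

Lemma xlnx_continuous (R : realType) : continuous (fun x : R => x * ln x).
Proof.
move=> x; have [x_lt0|x_gt0|x_eq0] := ltgtP x 0.
- rewrite /continuous_at [x * _]mulrC ln0 ?ltW // mul0r.
  apply: cvg_trans (cvg_cst (0 : R) (F := nbhs x)).
  apply: near_eq_cvg; near=> y; rewrite ln0 ?mulr0 //.
  by apply/ltW; near: y; exact: lt_nbhsl.
- by apply: continuousM; [exact: cvg_id|exact: continuous_ln].
(* At 0 the function is squeezed between [-2 sqrt y] and 0, the upper bound holding for [y < 1]. *)
- rewrite /continuous_at x_eq0 mul0r.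
  apply: (@squeeze_cvgr _ _ _ _ (fun y => - (Num.sqrt y *+ 2)) (fun=> 0)).
  + near=> y; rewrite xlnx_ge /=; have [y_le0|y_gt0] := leP y 0.
      by rewrite ln0 // mulr0.
    rewrite (mulr_ge0_le0 (ltW y_gt0)) // ln_le0 // ltW //.
    by near: y; exact: lt_nbhsl.
  + have s0 := @sqrt_continuous R 0.
    by have := cvgN (cvgD s0 s0); rewrite sqrtr0 addr0 oppr0; apply; exact: nbhs_filter.
  + exact: cvg_cst.
Unshelve. all: by end_near. Qed.

Section Continuity.
Context {R : realType}.

Lemma add_continuous_fun (T : topologicalType) (f g : T -> R) :
  continuous f -> continuous g -> continuous (fun t => f t + g t).
Proof. by move=> fc gc t; apply: continuousD; [exact: fc|exact: gc]. Qed.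

Lemma sub_continuous_fun (T : topologicalType) (f g : T -> R) :
  continuous f -> continuous g -> continuous (fun t => f t - g t).
Proof. by move=> fc gc t; apply: continuousB; [exact: fc|exact: gc]. Qed.

Lemma mul_continuous_fun (T : topologicalType) (f g : T -> R) :
  continuous f -> continuous g -> continuous (fun t => f t * g t).
Proof. by move=> fc gc t; apply: continuousM; [exact: fc|exact: gc]. Qed.

Lemma sum_continuous (T : topologicalType) (I : finType) (P : pred I)
    (f : I -> T -> R) :
  (forall i, continuous (f i)) -> continuous (fun t => \sum_(i | P i) f i t).
Proof.
move=> fc; elim: (index_enum I) => [|i s IH].
  rewrite (_ : (fun t => _) = fun=> 0); first exact: cst_continuous.
  by apply/funext => t; rewrite big_nil.
have [Pi|nPi] := boolP (P i); last first.
  by rewrite (_ : (fun t => _) = fun t => \sum_(j <- s | P j) f j t) //;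
     apply/funext => t; rewrite big_cons (negPf nPi).
rewrite (_ : (fun t => _) = fun t => f i t + \sum_(j <- s | P j) f j t).
  exact: add_continuous_fun.
by apply/funext => t; rewrite big_cons Pi.
Qed.

Lemma ptws_coord_continuous (I : eqType) (i : I) :
  continuous (fun T : {ptws I -> R} => T i).
Proof. exact: (@proj_continuous I (fun=> R) i). Qed.

(** The pointwise topology is the supremum of the topologies pulled back along the coordinates. *)
Lemma ptws_continuous (T : topologicalType) (I : Type) (f : T -> {ptws I -> R}) :
  (forall i, continuous (fun t => f t i)) -> continuous f.
Proof.
move=> fc t; apply/cvg_sup => i; apply/cvg_image.
  by apply/seteqP; split=> // v _; exists (fun=> v).
move=> W /(fc i t) Wt; exists (@^~ i @^-1` W) => //.
by apply/seteqP; split=> [_ [g Wg <-]|v Wv] //; exists (fun=> v).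
Qed.

(** Used in both directions, the one-sided bound squeezes [f] between [f w0 - D] and [f w0 + D],
    where [D] is continuous and vanishes at [w0]. *)
Lemma ptws_lipschitz_continuous (I : finType) (f : (I -> R) -> R) (M : R) :
    (forall w w', f w <= f w' + M * \sum_i `|w i - w' i|) ->
  continuous (f : {ptws I -> R} -> R).
Proof.
move=> lip w0; pose D (w : {ptws I -> R}) := M * \sum_i `|w i - w0 i|.
have D0 : D w0 = 0.
  by rewrite /D big1 ?mulr0 // => i _; rewrite subrr normr0.
have Dc : continuous D.
  apply: mul_continuous_fun; first exact: cst_continuous.
  apply: sum_continuous => i w.
  apply: (@continuous_comp _ _ _ (fun w : {ptws I -> R} => w i - w0 i)).
    apply: sub_continuous_fun; last exact: cst_continuous.
    exact: ptws_coord_continuous.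
  exact: norm_continuous.
have lo : (fun w => f w0 - D w) @ w0 --> f w0.
  rewrite -[X in _ --> X]subr0 -D0.
  exact: (sub_continuous_fun (@cst_continuous _ _ (f w0)) Dc).
have hi : (fun w => f w0 + D w) @ w0 --> f w0.
  rewrite -[X in _ --> X]addr0 -D0.
  exact: (add_continuous_fun (@cst_continuous _ _ (f w0)) Dc).
apply: squeeze_cvgr lo hi; apply: nearW => w; rewrite lip andbT lerBlDr.
apply: le_trans (lip w0 w) _; rewrite lerD2l /D.
by under eq_bigr do rewrite distrC.
Qed.

Lemma closed_le_continuous (T : topologicalType) (f g : T -> R) :
  continuous f -> continuous g -> closed [set t | f t <= g t].
Proof.
move=> fc gc; rewrite (_ : [set _ | _] = (g \- f) @^-1` [set x | 0 <= x]).
  by apply: closed_comp (@closed_ge _ 0) => t _; exact: sub_continuous_fun.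
by apply/seteqP; split => t /=; rewrite subr_ge0.
Qed.

Lemma closed_eq_continuous (T : topologicalType) (f g : T -> R) :
  continuous f -> continuous g -> closed [set t | f t = g t].
Proof.
move=> fc gc; rewrite (_ : [set _ | _] = [set t | f t <= g t] `&` [set t | g t <= f t]).
  by apply: closedI; exact: closed_le_continuous.
apply/seteqP; split => t /=; first by move=> ->.
by case=> fg gf; apply/le_anti; rewrite fg gf.
Qed.

Lemma box_compact (I : eqType) :
  compact [set T : {ptws I -> R} | forall i, 0 <= T i <= 1].
Proof.
rewrite (_ : [set _ | _] = [set T | forall i, `[0, 1]%classic (T i)]).
  by apply: (@tychonoff I (fun=> R) (fun=> `[0, 1]%classic)) => i;
    exact: segment_compact.
by apply/seteqP; split => T /= T01 i; have := T01 i; rewrite in_itv.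
Qed.

Lemma simplex_compact (I : finType) :
  compact [set mu : {ptws I -> R} | (forall i, 0 <= mu i) /\ \sum_i mu i = 1].
Proof.
apply: (subclosed_compact _ (@box_compact I)).
  rewrite (_ : [set _ | _] =
      (\bigcap_i [set mu : {ptws I -> R} | 0 <= mu i]) `&` [set mu | \sum_i mu i = 1]).
    apply: closedI.
      apply: closed_bigI => i _.
      apply: closed_le_continuous; first exact: cst_continuous.
      exact: ptws_coord_continuous.
    apply: closed_eq_continuous; last exact: cst_continuous.
    by apply: sum_continuous => i; exact: ptws_coord_continuous.
  by apply/seteqP; split => mu [mu0 mu1]; split=> // i *; exact: mu0.
move=> mu /= [mu0 mu1] i; rewrite mu0 -mu1 (bigD1 i) //= lerDl.
exact: sumr_ge0.
Qed.

(** The extreme value theorem for plain functions, so that the pointwise topology appears only in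
    the compactness and continuity premises. *)
Lemma ptws_EVT_max (I : eqType) (f : (I -> R) -> R) (A : set (I -> R)) :
    A !=set0 -> compact (A : set {ptws I -> R}) ->
    continuous (f : {ptws I -> R} -> R) ->
  exists2 c, A c & forall t, A t -> f t <= f c.
Proof.
move=> A0 cA cf.
have [c /set_mem Ac cmax] := @compact_EVT_max {ptws I -> R} R f A A0 cA
  (continuous_subspaceT cf).
by exists c => // t At; exact/cmax/mem_set.
Qed.

Lemma ptws_EVT_min (I : eqType) (f : (I -> R) -> R) (A : set (I -> R)) :
    A !=set0 -> compact (A : set {ptws I -> R}) ->
    continuous (f : {ptws I -> R} -> R) ->
  exists2 c, A c & forall t, A t -> f c <= f t.
Proof.
move=> A0 cA cf.
have [c /set_mem Ac cmin] := @compact_EVT_min {ptws I -> R} R f A A0 cA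
  (continuous_subspaceT cf).
by exists c => // t At; exact/cmin/mem_set.
Qed.

End Continuity.

(** * The constraint set and the free energy on it *)

Section FreeEnergy.
Context {R : realType} {V : finType} {adj : rel V} {E : {set V * V}} {m : nat}.
Implicit Types (T theta : model_index E m -> R) (w : edge E -> R).

(** A positive edge entry thus forces positive node entries, which is what permits splitting the
    logarithm in [mutual_infoE]. *)
Lemma pseudomarginals_le T a j k : pseudomarginals T ->
  edge_marg T a j k <= node_marg T (src a) j /\
  edge_marg T a j k <= node_marg T (tgt a) k.
Proof.
case=> T_ge0 _ T_src T_tgt; split.
  by rewrite -T_src (bigD1 k) //= lerDl; apply: sumr_ge0 => l _; exact: T_ge0.
by rewrite -T_tgt (bigD1 j) //= lerDl; apply: sumr_ge0 => l _; exact: T_ge0.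
Qed.

(** The constraints are closed conditions on finitely many coordinates, and they confine every entry
    to the unit interval. *)
Lemma pseudomarginals_compact :
  compact (pseudomarginals : set {ptws model_index E m -> R}).
Proof.
apply: (subclosed_compact _ (@box_compact R (model_index E m))).
  rewrite (_ : pseudomarginals =
      (\bigcap_i [set T : {ptws model_index E m -> R} | 0 <= T i]) `&`
      (\bigcap_s [set T | \sum_j node_marg T s j = 1]) `&`
      (\bigcap_a \bigcap_j
        [set T | \sum_k edge_marg T a j k = node_marg T (src a) j]) `&`
      (\bigcap_a \bigcap_k
        [set T | \sum_j edge_marg T a j k = node_marg T (tgt a) k])).
    repeat apply: closedI; apply: closed_bigI => i _.
    - apply: closed_le_continuous; first exact: cst_continuous.
      exact: ptws_coord_continuous.
    - apply: closed_eq_continuous; last exact: cst_continuous.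
      by apply: sum_continuous => j; exact: ptws_coord_continuous.
    - apply: closed_bigI => j _.
      apply: closed_eq_continuous; last exact: ptws_coord_continuous.
      by apply: sum_continuous => k; exact: ptws_coord_continuous.
    - apply: closed_bigI => j _.
      apply: closed_eq_continuous; last exact: ptws_coord_continuous.
      by apply: sum_continuous => k; exact: ptws_coord_continuous.
  apply/seteqP; split => T.
    case=> T0 T1 T2 T3; split; [split; [split|]|] => i _.
    - exact: T0.
    - exact: T1.
    - by move=> j _; exact: T2.
    - by move=> k _; exact: T3.
  case=> -[[T0 T1] T2] T3; split => [i|s|a j|a k].
  - exact: T0.
  - exact: T1.
  - exact: (T2 a I j I).
  - exact: (T3 a I k I).
move=> T TC i; have [T_ge0 T_sum _ _] := TC; rewrite T_ge0 /=.
have node s j : node_marg T s j <= 1.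
  by rewrite -(T_sum s) (bigD1 j) //= lerDl; apply: sumr_ge0 => k _; exact: T_ge0.
case: i => [[s j]|[a [j k]]]; first exact: node.
exact: le_trans (pseudomarginals_le a j k TC).1 (node _ _).
Qed.

Definition xlnx (x : R) : R := x * ln x.

(** This is mutual information in the form [H_s + H_t - H_st]. *)
Definition mutual_info_xlnx T (a : edge E) : R :=
  \sum_j \sum_k xlnx (edge_marg T a j k) - \sum_j xlnx (node_marg T (src a) j)
  - \sum_k xlnx (node_marg T (tgt a) k).

(* Unlike [mutual_info], whose logarithm jumps where a marginal vanishes,
   the right-hand side is continuous on the whole function space. *)
Lemma mutual_infoE T a : pseudomarginals T ->
  mutual_info (node_marg T (src a)) (node_marg T (tgt a)) (edge_marg T a) =
  mutual_info_xlnx T a.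
Proof.
move=> TC; have [T_ge0 _ T_src T_tgt] := TC.
rewrite /mutual_info_xlnx.
transitivity (\sum_j \sum_k (xlnx (edge_marg T a j k)
    - edge_marg T a j k * ln (node_marg T (src a) j)
    - edge_marg T a j k * ln (node_marg T (tgt a) k))).
  apply: eq_bigr => j _; apply: eq_bigr => k _; rewrite /xlnx.
  have [q_le0|q_gt0] := leP (edge_marg T a j k) 0.
    have -> : edge_marg T a j k = 0 by apply/le_anti; rewrite q_le0 T_ge0.
    by rewrite !mul0r !subr0.
  have [ps pt] := pseudomarginals_le a j k TC.
  have ps0 := lt_le_trans q_gt0 ps; have pt0 := lt_le_trans q_gt0 pt.
  by rewrite ln_div ?posrE ?mulr_gt0 // lnM ?posrE // opprD addrA !mulrDr !mulrN.
under eq_bigr do rewrite !sumrB.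
rewrite !sumrB; congr (_ - _ - _).
  by apply: eq_bigr => j _; rewrite -mulr_suml T_src.
by rewrite exchange_big; apply: eq_bigr => k _; rewrite -mulr_suml T_tgt.
Qed.

Lemma coord_xlnx_continuous i :
  continuous (fun T : {ptws model_index E m -> R} => xlnx (T i)).
Proof.
move=> T; apply: (@continuous_comp _ _ _ (fun T : {ptws _ -> R} => T i) xlnx).
  exact: ptws_coord_continuous.
exact: xlnx_continuous.
Qed.

Lemma mutual_info_xlnx_continuous a :
  continuous (mutual_info_xlnx ^~ a : {ptws model_index E m -> R} -> R).
Proof.
apply: sub_continuous_fun; first apply: sub_continuous_fun.
- apply: sum_continuous => j; apply: sum_continuous => k.
  exact: coord_xlnx_continuous.
- by apply: sum_continuous => j; exact: coord_xlnx_continuous.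
- by apply: sum_continuous => j; exact: coord_xlnx_continuous.
Qed.

Definition free_energy_xlnx w theta T : R :=
  \sum_s \sum_j xlnx (node_marg T s j) + \sum_a w a * mutual_info_xlnx T a
  - \sum_i T i * theta i.

Lemma free_energyE T w theta : pseudomarginals T ->
  free_energy T w theta = free_energy_xlnx w theta T.
Proof.
move=> TC; rewrite /free_energy -sumrN; congr (_ + _ - _).
  by apply: eq_bigr => s _; rewrite opprK.
by apply: eq_bigr => a _; rewrite mutual_infoE.
Qed.

Lemma free_energy_xlnx_continuous w theta :
  continuous (free_energy_xlnx w theta : {ptws model_index E m -> R} -> R).
Proof.
apply: sub_continuous_fun; first apply: add_continuous_fun.
- apply: sum_continuous => s; apply: sum_continuous => j.
  exact: coord_xlnx_continuous.
- apply: sum_continuous => a; apply: mul_continuous_fun; first exact: cst_continuous.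
  exact: mutual_info_xlnx_continuous.
- apply: sum_continuous => i; apply: mul_continuous_fun; last exact: cst_continuous.
  exact: ptws_coord_continuous.
Qed.

End FreeEnergy.

(** * Optimization *)

Section Optimization.
Context {R : realType} {V : finType} {adj : rel V} {E : {set V * V}} {m : nat}.
Hypotheses (E_orient : orientation adj E) (m_gt0 : (0 < m)%N).
Variable theta : model_index E m -> R.

Let pseudomarginals_neq0 : (pseudomarginals : set (model_index E m -> R)) !=set0.
Proof. by exists (gibbs_marg theta); exact: (gibbs_marg_in E_orient). Qed.

Lemma free_energy_minimizer (w : edge E -> R) :
  exists2 T, pseudomarginals T &
    forall T', pseudomarginals T' -> free_energy T w theta <= free_energy T' w theta.
Proof.
have [T TC Tmin] := ptws_EVT_min pseudomarginals_neq0
  (@pseudomarginals_compact R V E m)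
  (@free_energy_xlnx_continuous R V E m w theta).
by exists T => // T' T'C; rewrite !free_energyE //; exact: Tmin.
Qed.

Lemma min_free_energy_is_minimum (w : edge E -> R) :
  is_minimum [set free_energy T w theta | T in pseudomarginals]
             (min_free_energy w theta).
Proof.
have [T TC Tmin] := free_energy_minimizer w.
have lb : lbound [set free_energy T w theta | T in pseudomarginals]
    (free_energy T w theta) by move=> _ [T' T'C <-]; exact: Tmin.
have -> : min_free_energy w theta = free_energy T w theta.
  apply/le_anti; rewrite lb_le_inf // ?andbT.
  - by apply: ge_inf; [exists (free_energy T w theta)|exists T].
  - by exists (free_energy T w theta), T.
by split => //; exists T.
Qed.

Lemma min_free_energy_le (w : edge E -> R) T : pseudomarginals T ->
  min_free_energy w theta <= free_energy T w theta.
Proof. by move=> TC; apply: (min_free_energy_is_minimum w).2; exists T. Qed.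

Lemma mutual_info_bounded :
  exists M : R, forall T : model_index E m -> R, pseudomarginals T ->
    forall a, `|mutual_info_xlnx T a| <= M.
Proof.
(* Maximising the sum over all edges gives one constant valid for every edge at once. *)
have cont : continuous (fun T : {ptws model_index E m -> R} =>
    \sum_a `|mutual_info_xlnx T a|).
  apply: sum_continuous => a T.
  apply: (@continuous_comp _ _ _ (mutual_info_xlnx ^~ a : {ptws _ -> R} -> R)).
    exact: mutual_info_xlnx_continuous.
  exact: norm_continuous.
have [T0 _ T0max] := ptws_EVT_max pseudomarginals_neq0
  (@pseudomarginals_compact R V E m) cont.
exists (\sum_a `|mutual_info_xlnx T0 a|) => T TC a.
apply: le_trans (T0max T TC).
by rewrite (bigD1 a) //= lerDl; apply: sumr_ge0.
Qed.

(** A minimiser for [w'] is a competitor for [w], and its free energies at the two weights differ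
    only by the mutual information terms, which are bounded independently of the weights. *)
Lemma min_free_energy_lipschitz : exists M : R, forall w w' : edge E -> R,
  min_free_energy w theta <= min_free_energy w' theta + M * \sum_a `|w a - w' a|.
Proof.
have [M Mbound] := mutual_info_bounded; exists M => w w'.
have [[T TC <-] _] := min_free_energy_is_minimum w'.
apply: le_trans (min_free_energy_le w TC) _.
rewrite !free_energyE // /free_energy_xlnx -lerBlDl mulr_sumr.
rewrite [leLHS](_ : _ = \sum_a (w a - w' a) * mutual_info_xlnx T a); last first.
  rewrite opprB addrA subrK opprD addrACA subrr add0r.
  by under [RHS]eq_bigr do rewrite mulrBl; rewrite sumrB.
apply: ler_sum => a _; apply: le_trans (ler_norm _) _.
by rewrite normrM mulrC ler_wpM2r // Mbound.
Qed.

Lemma min_free_energy_continuous :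
  continuous (min_free_energy ^~ theta : {ptws edge E -> R} -> R).
Proof.
by have [M lip] := min_free_energy_lipschitz; exact: ptws_lipschitz_continuous lip.
Qed.

End Optimization.

(** The polytope is the image of a probability simplex under a map whose coordinates are finite
    sums, hence continuous. *)
Lemma spanning_tree_polytope_compact (R : realType) (V : finType) (E : {set V * V}) :
  compact (spanning_tree_polytope E R : set {ptws edge E -> R}).
Proof.
apply: (@continuous_compact {ptws spanning_tree E -> R} {ptws edge E -> R}
  (@edge_appearance V E R)); last exact: simplex_compact.
apply: continuous_subspaceT; apply: ptws_continuous => a.
by apply: sum_continuous => A; exact: ptws_coord_continuous.
Qed.

Theorem theorem2 (R : realType) (V : finType) (adj : rel V)
    (adj_simple : simple_graph adj) (adj_connected : connected_graph adj)
    (E : {set V * V}) (E_orient : orientation adj E)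
    (m : nat) (m_gt0 : (0 < m)%N) (theta : model_index E m -> R) :
  [/\ (* the minimum defining H exists *)
      forall w, spanning_tree_polytope E R w ->
        is_minimum [set free_energy T w theta | T in pseudomarginals]
                   (min_free_energy w theta),
      (* the jointly optimized bound *)
      log_partition theta <=
        - sup [set min_free_energy w theta | w in spanning_tree_polytope E R] &
      (* the maximum over the polytope is attained, and gives the best bound *)
      exists2 what, spanning_tree_polytope E R what &
        [/\ is_maximum [set min_free_energy w theta | w in spanning_tree_polytope E R]
                       (min_free_energy what theta),
            sup [set min_free_energy w theta | w in spanning_tree_polytope E R] =
              min_free_energy what theta &
            forall w, spanning_tree_polytope E R w ->
              log_partition theta <= - min_free_energy what theta
                                  <= - min_free_energy w theta]].
Proof.
(* The Gibbs marginals are a competitor in the minimum over the constraint set. *)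
have bound w : spanning_tree_polytope E R w ->
    log_partition theta <= - min_free_energy w theta.
  move=> wT; rewrite lerNr; apply: le_trans (free_energy_gibbs E_orient m_gt0 theta wT).
  exact/(min_free_energy_le E_orient)/(gibbs_marg_in E_orient).
(* Connectivity provides a spanning tree, and the point mass at it is a tree distribution. *)
have polytope_neq0 : spanning_tree_polytope E R !=set0.
  have [A /asboolP Atree] := spanning_tree_exists E_orient adj_connected.
  pose A0 : spanning_tree E := exist _ A Atree.
  exists (edge_appearance (fun A => (A == A0)%:R)), (fun A => (A == A0)%:R) => //.
  split=> [B|]; first exact: ler0n.
  by rewrite (bigD1 A0) //= eqxx big1 ?addr0 // => B /negPf ->.
have [what whatP what_le] := ptws_EVT_max polytope_neq0
  (@spanning_tree_polytope_compact R V E)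
  (min_free_energy_continuous E_orient m_gt0 (theta := theta)).
have ub : ubound [set min_free_energy w theta | w in spanning_tree_polytope E R]
    (min_free_energy what theta) by move=> _ [w wP <-]; exact: what_le.
have supE : sup [set min_free_energy w theta | w in spanning_tree_polytope E R] =
    min_free_energy what theta.
  apply/le_anti/andP; split.
    by apply: ge_sup ub; exists (min_free_energy what theta), what.
  by apply: ub_le_sup; [exists (min_free_energy what theta)|exists what].
split; first by move=> w _; exact: (min_free_energy_is_minimum E_orient).
  by rewrite supE bound.
exists what => //; split => //; first by split => //; exists what.
by move=> w wP; rewrite bound //= lerN2 what_le.
Qed.
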